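(* Let $\mathcal{K}$ denote the real line or the unit circle, and let $r\in\mathbb{N}$, $\alpha\in\mathbb{R}$. Let $\mu$ be a (non-negative) measure on $\mathcal{K}$ (defined at least on the Borel subsets of $\mathcal{K}$). Let $p_n$ be orthogonal polynomials on $\mathcal{K}$ with respect to $\mu$ (positivity of leading coefficients is not assumed): $$\int_{\mathcal{K}}p_n(z)\overline{p_m(z)}\,d\mu=A_n\delta_{n,m},\qquad A_n>0,\ n,m\in\mathbb{Z}_+,$$ and write $$p_n(z)=\sum_{j=0}^n\xi_{n,j}z^j,\qquad \xi_{n,j}\in\mathbb{C},\ \xi_{n,n}\ne0;\ n\in\mathbb{Z}_+.$$ Then the polynomials $$\widehat y_n(z)=\widehat y_n(r,\alpha;z)=\sum_{j=0}^n\xi_{n,j}\,y_j(r,\alpha;z),\qquad n\in\mathbb{Z}_+,$$ are Sobolev orthogonal polynomials on $\mathcal{K}$: $$\int_{\mathcal{K}}\left(\widehat y_n(z),\widehat y_n'(z),\dots,\widehat y_n^{(r)}(z)\right)M\,\overline{\begin{pmatrix}\widehat y_m(z)\\ \widehat y_m'(z)\\ \vdots\\ \widehat y_m^{(r)}(z)\end{pmatrix}}\,d\mu=A_n\delta_{n,m},\qquad n,m\in\mathbb{Z}_+,$$ where $M=(1,0,\dots,0,\alpha)^T(1,0,\dots,0,\alpha)$ is an $(r+1)\times(r+1)$ matrix.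
   Context: $\mathbb{N}$: positive integers; $\mathbb{Z}_+$: non-negative integers; $[a]$ denotes the greatest integer $\le a$. For $r\in\mathbb{N}$, $\alpha\in\mathbb{R}$, $$y_n(r,\alpha;z):=z^n+n!\sum_{k=1}^{[n/r]}(-\alpha)^k\frac{z^{n-kr}}{(n-kr)!},\qquad n\in\mathbb{Z}_+.$$ An overline denotes (entrywise) complex conjugation and $T$ the transpose. *)

(* Defs.v *)
From HB Require Import structures.
From mathcomp Require Import all_boot all_order all_algebra.
From mathcomp Require Import complex.
From mathcomp Require Import all_classical all_reals all_analysis.

Set Implicit Arguments.
Unset Strict Implicit.
Unset Printing Implicit Defensive.

Import Order.TTheory GRing.Theory Num.Theory.
Import numFieldNormedType.Exports.

Local Open Scope classical_set_scope.
Local Open Scope ring_scope.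
Local Open Scope complex_scope.

Variant curve := RealLine | UnitCircle.

Definition on_curve (R : realType) (K : curve) (z : R[i]) : bool :=
  match K with
  | RealLine => complex.Im z == 0
  | UnitCircle => `|z| == 1
  end.

Definition curve_pt (R : realType) (K : curve) : Type :=
  {z : R[i] | on_curve K z}.

Lemma on_curve1 (R : realType) (K : curve) : on_curve K (1 : R[i]).
Proof. by case: K; rewrite /= ?eqxx ?normr1. Qed.

HB.instance Definition _ (R : realType) (K : curve) :=
  Choice.copy (curve_pt R K) {z : R[i] | on_curve K z}.
(* Measurable types are pointed; 1 lies on both curves. *)
HB.instance Definition _ (R : realType) (K : curve) :=
  isPointed.Build (curve_pt R K) (exist _ 1 (on_curve1 R K)).

Definition curve_val (R : realType) (K : curve) (x : curve_pt R K) : R[i] :=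
  sval x.

(* Generated by the relatively open subsets of the curve; R[i]^o carries the
   topology of the complex modulus. *)
Definition curve_borel (R : realType) (K : curve) : set (set (curve_pt R K)) :=
  <<s preimage_set_system [set: curve_pt R K]
        (@curve_val R K : curve_pt R K -> R[i]^o) open >>.
Arguments curve_borel : clear implicits.

Definition cintegrable (d : measure_display) (T : measurableType d)
    (R : realType) (mu : {measure set T -> \bar R}) (D : set T)
    (f : T -> R[i]) : Prop :=
  mu.-integrable D (fun x => (complex.Re (f x))%:E) /\
  mu.-integrable D (fun x => (complex.Im (f x))%:E).

(* Meaningful only for functions satisfying [cintegrable]. *)
Definition cintegral (d : measure_display) (T : measurableType d)
    (R : realType) (mu : {measure set T -> \bar R}) (D : set T)
    (f : T -> R[i]) : R[i] :=
  (\int[mu]_(x in D) complex.Re (f x)) +i* (\int[mu]_(x in D) complex.Im (f x)).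

Definition ypoly (R : realType) (r : nat) (alpha : R) (n : nat) :
    {poly R[i]} :=
  'X^n + (n`!)%:R *:
    \sum_(1 <= k < (n %/ r).+1)
      ((- alpha%:C) ^+ k / ((n - k * r)`!)%:R) *: 'X^(n - k * r).

Definition yhat (R : realType) (r : nat) (alpha : R) (xi : nat -> nat -> R[i])
    (n : nat) : {poly R[i]} :=
  \sum_(j < n.+1) xi n j *: ypoly r alpha j.

Definition jet (R : realType) (r : nat) (p : {poly R[i]}) (z : R[i]) :
    'rV[R[i]]_(r.+1) :=
  \row_(k < r.+1) (p^`(k)).[z].

(* (1, 0, ..., 0, alpha), meant for 0 < r. *)
Definition sobolev_row (R : realType) (r : nat) (alpha : R) :
    'rV[R[i]]_(r.+1) :=
  \row_(k < r.+1)
    (if k == ord0 then 1 else if k == ord_max then alpha%:C else 0).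

Definition sobolev_mx (R : realType) (r : nat) (alpha : R) :
    'M[R[i]]_(r.+1) :=
  (sobolev_row r alpha)^T *m sobolev_row r alpha.

Definition sobolev_form (R : realType) (r : nat) (alpha : R)
    (p q : {poly R[i]}) (z : R[i]) : R[i] :=
  (jet r p z *m sobolev_mx r alpha *m map_mx (@conjc R) (jet r q z)^T) 0 0.

(* Main.v *)
Require Import Defs.
From mathcomp Require Import all_boot all_order all_algebra.
From mathcomp Require Import complex.
From mathcomp Require Import all_classical all_reals all_analysis.
Import Order.TTheory GRing.Theory Num.Theory.
Local Open Scope classical_set_scope.
Local Open Scope ring_scope.
Local Open Scope complex_scope.

(** The polynomial [ypoly r alpha n] is the truncated Neumann series of
    the operator [1 + alpha D^r] applied to [X^n], where [D] is the derivative: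
    as [D^(k r) X^n = n! / (n - k r)! X^(n - k r)],
      [y_n = sum_(0 <= k <= n / r) (- alpha D^r)^k X^n],
    and the series stops there because [D^(k r) X^n = 0] once [k r > n].  Hence
    the sum telescopes to [y_n + alpha y_n^(r) = X^n]
    ([sobolev_op_ypoly]), and by linearity [1 + alpha D^r] maps [yhat n] back
    to [p n].

    On the other side the matrix of the Sobolev form has rank one, so the form
    is a product, [sobolev_form p q = L p * conj (L q)] with
    [L = 1 + alpha D^r] ([sobolev_form_factor]).  The Sobolev integrand of
    [yhat n] and [yhat m] is therefore equal, at every point, to the integrand
    [p n * conj (p m)], and the orthogonality relations are the same
    statement. *)

Definition sobolev_op {R : realType} (r : nat) (alpha : R)
    (q : {poly R[i]}) : {poly R[i]} :=
  q + alpha%:C *: q^`(r).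

Lemma sobolev_op_sum {R : realType} (r : nat) (alpha : R) (n : nat)
    (c : 'I_n -> R[i]) (q : 'I_n -> {poly R[i]}) :
  sobolev_op r alpha (\sum_(j < n) c j *: q j)
  = \sum_(j < n) c j *: sobolev_op r alpha (q j).
Proof.
rewrite /sobolev_op raddf_sum scaler_sumr -big_split; apply: eq_bigr => j _ /=.
by rewrite derivnZ -!mul_polyC mulrDr [in RHS]mulrCA.
Qed.

(** The defining formula with its factorial quotients read as the coefficients
    of the derivatives of [X^n]; the isolated [X^n] is the term [k = 0]. *)
Lemma ypoly_neumann {R : realType} (r : nat) (alpha : R) (n : nat) :
  ypoly r alpha n
  = \sum_(0 <= k < (n %/ r).+1) (- alpha%:C) ^+ k *: ('X^n)^`(k * r).
Proof.
rewrite big_ltn // expr0 scale1r mul0n derivn0 /ypoly; congr (_ + _).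
rewrite scaler_sumr; apply: eq_big_nat => k /andP[_ lekN].
have lekrn : (k * r <= n)%N.
  by apply: leq_trans (leq_divM n r); rewrite leq_mul2r -ltnS lekN orbT.
rewrite derivnXn scalerA -[_ *+ n ^_ _]scaler_nat scalerA; congr (_ *: _).
by rewrite -(ffact_fact lekrn) natrM mulrACA divff ?mulr1 1?mulrC.
Qed.

(** [alpha D^r] carries each Neumann term to the opposite of the next one, so
    only the initial [X^n] and the first truncated term survive. *)
Lemma sobolev_op_ypoly {R : realType} (r : nat) (alpha : R) (n : nat) :
  (0 < r)%N -> sobolev_op r alpha (ypoly r alpha n) = 'X^n.
Proof.
move=> r_gt0; rewrite ypoly_neumann.
pose u k : {poly R[i]} := (- alpha%:C) ^+ k *: ('X^n)^`(k * r).
have shift k : alpha%:C *: (u k)^`(r) = - u k.+1.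
  rewrite /u derivnZ scalerA /derivn -iterD -mulSn exprS -scaleNr.
  by rewrite mulNr opprK.
rewrite /sobolev_op -/(u _) raddf_sum scaler_sumr -big_split /=.
rewrite (eq_bigr (fun k => - (u k.+1 - u k))); last first.
  by move=> k _; rewrite shift opprB.
rewrite sumrN telescope_sumr // opprB {1}/u expr0 scale1r mul0n derivn0.
(* The truncated term differentiates [X^n] more than [n] times. *)
by rewrite /u derivnXn ffact_small ?mulr0n ?scaler0 ?subr0 // -ltn_divLR.
Qed.

Lemma sobolev_op_yhat {R : realType} (r : nat) (alpha : R)
    (xi : nat -> nat -> R[i]) (n : nat) :
  (0 < r)%N ->
  sobolev_op r alpha (yhat r alpha xi n) = \sum_(j < n.+1) xi n j *: 'X^j.
Proof.
move=> r_gt0; rewrite sobolev_op_sum.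
by apply: eq_bigr => j _; rewrite sobolev_op_ypoly.
Qed.

(** Positivity of [r] makes the first and last entries of the row distinct, so
    that both contribute. *)
Lemma jet_mul_sobolev_row {R : realType} (r : nat) (alpha : R)
    (q : {poly R[i]}) (z : R[i]) :
  (0 < r)%N ->
  (jet r q z *m (sobolev_row r alpha)^T) 0 0 = (sobolev_op r alpha q).[z].
Proof.
case: r => // r _; rewrite mxE big_ord_recl big_ord_recr /= big1 => [|k _].
  by rewrite !mxE /= mulr1 add0r -val_eqE eqxx hornerD hornerZ mulrC.
by rewrite !mxE /= -val_eqE [_ == _]ltn_eqF ?mulr0 //= ltnS.
Qed.

(** The matrix is a column times a row, which splits the form into one factor
    for each polynomial; as [alpha] is real, conjugating the jet of [q2]
    conjugates the whole second factor. *)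
Lemma sobolev_form_factor {R : realType} (r : nat) (alpha : R)
    (q1 q2 : {poly R[i]}) (z : R[i]) :
  (0 < r)%N ->
  sobolev_form r alpha q1 q2 z
  = (sobolev_op r alpha q1).[z] * conjc (sobolev_op r alpha q2).[z].
Proof.
move=> r_gt0; rewrite /sobolev_form /sobolev_mx mulmxA -mulmxA.
rewrite mxE big_ord1 jet_mul_sobolev_row //; congr (_ * _).
rewrite -jet_mul_sobolev_row // !mxE rmorph_sum.
apply: eq_bigr => k _; rewrite !mxE rmorphM mulrC; congr (_ * _).
by do 2?case: ifP => _; rewrite ?rmorph1 ?rmorph0 //= oppr0.
Qed.

Theorem corollary2 (R : realType) (K : curve) (r : nat) (hr : (0 < r)%N)
    (alpha : R)
    (Sg : set (set (curve_pt R K)))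
    (hS : sigma_algebra [set: curve_pt R K] Sg)
    (hSborel : curve_borel R K `<=` Sg)
    (mu : {measure set (g_sigma_algebraType Sg) -> \bar R})
    (p : nat -> {poly R[i]}) (xi : nat -> nat -> R[i]) (A : nat -> R)
    (hp : forall n : nat, p n = \sum_(j < n.+1) xi n j *: 'X^j)
    (hxi : forall n : nat, xi n n != 0)
    (hA : forall n : nat, 0 < A n)
    (horth : forall n m : nat,
      let f := fun x : g_sigma_algebraType Sg =>
        (p n).[curve_val x] * conjc (p m).[curve_val x] in
      cintegrable mu [set: g_sigma_algebraType Sg] f /\
      cintegral mu [set: g_sigma_algebraType Sg] f = (A n)%:C *+ (n == m)) :
  forall n m : nat,
    let g := fun x : g_sigma_algebraType Sg =>
      sobolev_form r alpha (yhat r alpha xi n) (yhat r alpha xi m)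
        (curve_val x) in
    cintegrable mu [set: g_sigma_algebraType Sg] g /\
    cintegral mu [set: g_sigma_algebraType Sg] g = (A n)%:C *+ (n == m).
Proof.
move=> n m g.
suff -> : g = fun x => (p n).[curve_val x] * conjc (p m).[curve_val x].
  exact: horth n m.
apply/funext => x.
by rewrite /g sobolev_form_factor // !sobolev_op_yhat // !hp.
Qed.
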